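(* Suppose that $\mathcal{A}$ is a unital $C^*$-algebra and $S$ is an admissible collection of linear symmetry maps on $\mathcal{A}$ so that $(\mathcal{A},S)$ has TR rank 1. Let $\epsilon_\ell(\delta)=\max(\epsilon_1(\delta),\epsilon_2(\delta))$, where $\epsilon_1,\epsilon_2$ are the functions described in the context. Then if $A\in\mathcal{A}$ is an $S$-symmetric contraction, there is a normal $S$-symmetric $A'\in\mathcal{A}$ that satisfies $$\|A'-A\|\le\epsilon_\ell(\|[A^*,A]\|).$$
   Context: ''Linear'' means $\mathbb{C}$-linear. A symmetry map on a unital $C^*$-algebra $\mathcal{A}$ is an $\mathbb{R}$-linear map $\varphi:\mathcal{A}\to\mathcal{A}$ that is hermitian ($\varphi(A^* )=\varphi(A)^*$), maps non-invertible elements to non-invertible elements, satisfies $\varphi(I)=I$, is linear or conjugate-linear ($\varphi(cA)=\overline{c}\varphi(A)$), and is multiplicative ($\varphi(AB)=\varphi(A)\varphi(B)$) or anti-multiplicative ($\varphi(AB)=\varphi(B)\varphi(A)$). Its type is the combination linear/conjugate-linear and multiplicative/anti-multiplicative. $\varphi$ has order $k$ if $k\ge1$ is the smallest integer with $\varphi^k=\mathrm{id}$. For a set $S$ of symmetry maps, $A$ is $S$-symmetric if $\varphi(A)=A$ for all $\varphi\in S$, and $\mathcal{A}_S$ is the set of $S$-symmetric elements. $(\mathcal{A},S)$ has TR rank 1 if the invertible elements of $\mathcal{A}_S$ are dense in $\mathcal{A}_S$. $S$ is admissible if for each type of symmetry map occurring in $S$ other than linear multiplicative, there is a symmetry map in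 $S$ of that type that commutes with every symmetry map in $S$. A contraction is an element of norm at most $1$. $\epsilon_1$ (from the Friis–Rørdam theorem) and $\epsilon_2$ (from the Loring–Sørensen theorem) are fixed monotonically increasing functions with $\lim_{\delta\to0}\epsilon_i(\delta)=0$ such that: (1) for every unital $C^*$-algebra $\mathcal{B}$ with stable rank 1 and every contraction $A\in\mathcal{B}$, there is a normal $A'\in\mathcal{B}$ with $\|A'-A\|\le\epsilon_1(\|[A^*,A]\|)$; (2) for every unital $C^*$-algebra $\mathcal{B}$ and every linear anti-multiplicative symmetry map $\tau$ on $\mathcal{B}$ of order $2$ such that $(\mathcal{B},\{\tau\})$ has TR rank 1, and every $\tau$-symmetric contraction $A\in\mathcal{B}$, there is a normal $\tau$-symmetric $A'\in\mathcal{B}$ with $\|A'-A\|\le\epsilon_2(\|[A^*,A]\|)$. *)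

(* Defs.v *)
From HB Require Import structures.
From mathcomp Require Import all_boot all_order all_algebra.
From mathcomp Require Import all_classical all_reals all_analysis.
From mathcomp Require Import complex.

Set Implicit Arguments.
Unset Strict Implicit.
Unset Printing Implicit Defensive.

Import Order.TTheory GRing.Theory Num.Theory.
Import numFieldNormedType.Exports.

Local Open Scope classical_set_scope.
Local Open Scope ring_scope.
Local Open Scope complex_scope.

(* Normed C-algebras cannot be obtained as a join of [GRing.Algebra] and
   [NormedModule]: Hierarchy-Builder already has [Num.NumDomain] as the only
   join of [GRing.PzSemiRing] and [Num.SemiNormedZmodule].  The norm is
   therefore a (real-valued) operation of the structure, from which the
   library's [normedModType R[i]] structure, and so its topology, is derived.
   [algType] is built on [nzRingType], hence 1 != 0. *)
HB.mixin Record isNormedAlgebra (R : realType) A & GRing.Algebra R[i] A := {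
  alg_norm : A -> R ;
  alg_normD : forall a b : A, alg_norm (a + b) <= alg_norm a + alg_norm b ;
  alg_normZ : forall (c : R[i]) (a : A),
    (alg_norm (c *: a))%:C = `|c| * (alg_norm a)%:C ;
  alg_norm0_eq0 : forall a : A, alg_norm a = 0 -> a = 0 ;
  alg_normM : forall a b : A, alg_norm (a * b) <= alg_norm a * alg_norm b
}.

#[short(type="normedAlgType")]
HB.structure Definition NormedAlgebra (R : realType) :=
  {A of isNormedAlgebra R A & GRing.Algebra R[i] A}.

Section NormedAlgebraTopology.
Context {R : realType} (A : normedAlgType R).

Let ler_normD (a b : A) :
  (alg_norm (a + b))%:C <= (alg_norm a)%:C + (alg_norm b)%:C :> R[i].
Proof. by rewrite -rmorphD lecR alg_normD. Qed.

Let norm_eq0 (a : A) : (alg_norm a)%:C = 0 :> R[i] -> a = 0.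
Proof. by move=> /complexI; exact: alg_norm0_eq0. Qed.

HB.instance Definition _ :=
  @Lmodule_isNormed.Build R[i] A (fun a => (alg_norm a)%:C)
    ler_normD (@alg_normZ R A) norm_eq0.
End NormedAlgebraTopology.

Definition norm_complete (R : realType) (A : normedAlgType R) : Prop :=
  forall F : set_system A, ProperFilter F -> cauchy F -> cvg F.

HB.mixin Record isCStarAlgebra (R : realType) A & NormedAlgebra R A := {
  cstar_complete : norm_complete A ;
  star : A -> A ;
  starK : involutive star ;
  starD : forall a b : A, star (a + b) = star a + star b ;
  starZ : forall (c : R[i]) (a : A), star (c *: a) = c^* *: star a ;
  starM : forall a b : A, star (a * b) = star b * star a ;
  alg_norm_starM : forall a : A, alg_norm (star a * a) = alg_norm a ^+ 2
}.

#[short(type="cstarAlgType")]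
HB.structure Definition CStarAlgebra (R : realType) :=
  {A of isCStarAlgebra R A & NormedAlgebra R A}.

HB.instance Definition _ (R : realType) (A : cstarAlgType R) :=
  NormedModule.copy A (A : normedAlgType R).

Section CStar.
Context {R : realType} {A : cstarAlgType R}.
Implicit Types (a b : A) (phi psi : A -> A) (S : set (A -> A)).

Definition cstar_contraction a : Prop := alg_norm a <= 1.

Definition cstar_commutator a b : A := a * b - b * a.

Definition cstar_normal a : Prop := star a * a = a * star a.

Definition invertible_elt a : Prop := exists b : A, a * b = 1 /\ b * a = 1.

Definition stable_rank1 : Prop := dense [set a : A | invertible_elt a].

Definition real_linear phi : Prop :=
  (forall a b, phi (a + b) = phi a + phi b) /\
  (forall (r : R) a, phi (r%:C *: a) = r%:C *: phi a).

Variant scalar_kind := Linear | ConjugateLinear.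
Variant product_kind := Multiplicative | AntiMultiplicative.

Definition respects_scalars (k : scalar_kind) phi : Prop :=
  match k with
  | Linear => forall (c : R[i]) a, phi (c *: a) = c *: phi a
  | ConjugateLinear => forall (c : R[i]) a, phi (c *: a) = c^* *: phi a
  end.

Definition respects_products (k : product_kind) phi : Prop :=
  match k with
  | Multiplicative => forall a b, phi (a * b) = phi a * phi b
  | AntiMultiplicative => forall a b, phi (a * b) = phi b * phi a
  end.

Definition has_type (s : scalar_kind) (p : product_kind) phi : Prop :=
  respects_scalars s phi /\ respects_products p phi.

Record symmetry_map phi : Prop := SymmetryMap {
  symmetry_real_linear : real_linear phi ;
  symmetry_hermitian : forall a, phi (star a) = star (phi a) ;
  symmetry_noninvertible : forall a, ~ invertible_elt a -> ~ invertible_elt (phi a) ;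
  symmetry_unital : phi 1 = 1 ;
  symmetry_type : exists s p, has_type s p phi
}.

Definition has_order phi (k : nat) : Prop :=
  [/\ (0 < k)%N, iter k phi =1 id &
      forall j : nat, (0 < j < k)%N -> ~ (iter j phi =1 id)].

Definition symmetric_elements S : set A :=
  [set a | forall phi, S phi -> phi a = a].

Definition TR_rank1 S : Prop :=
  symmetric_elements S `<=`
    closure (symmetric_elements S `&` [set a | invertible_elt a]).

Definition admissible S : Prop :=
  forall (s : scalar_kind) (p : product_kind),
    (s, p) <> (Linear, Multiplicative) ->
    (exists2 phi, S phi & has_type s p phi) ->
    exists psi, [/\ S psi, has_type s p psi &
      forall phi, S phi -> psi \o phi =1 phi \o psi].

Definition linear_symmetries S : Prop :=
  forall phi, S phi -> symmetry_map phi /\ respects_scalars Linear phi.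

End CStar.

Arguments stable_rank1 {R} A.

(* The gauge functions live on [0, +oo[; their values at negative arguments
   are irrelevant. *)
Definition monotone_gauge (R : realType) (eps : R -> R) : Prop :=
  {in Num.nneg &, {homo eps : x y / x <= y}} /\
  eps x @[x --> 0^'+] --> (0 : R).

(* Main.v *)
Require Import Defs.
From HB Require Import structures.
From mathcomp Require Import all_boot all_order all_algebra.
From mathcomp Require Import all_classical all_reals all_analysis.
From mathcomp Require Import complex ring lra.

Set Implicit Arguments.
Unset Strict Implicit.
Unset Printing Implicit Defensive.

Import Order.TTheory GRing.Theory Num.Theory.
Import numFieldNormedType.Exports.

Local Open Scope classical_set_scope.
Local Open Scope ring_scope.
Local Open Scope complex_scope.

(** An S-symmetric element is sought inside the set of S-symmetric elements,
    so that set, or a slightly larger C*-algebra carrying one involution, has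
    to be fed to one of the two given theorems.

    If every member of S is multiplicative, the S-symmetric elements form a
    unital C*-subalgebra.  The TR rank hypothesis says exactly that this
    algebra has stable rank 1, and the first theorem applies to it.

    Otherwise admissibility provides an anti-multiplicative tau in S that
    commutes with S.  Composing each anti-multiplicative member of S with tau
    gives multiplicative maps; together with the multiplicative members of S
    they have a C*-algebra B of common fixed points.  Since tau commutes with
    S, it restricts to B, and since tau^2 is one of the maps fixing B, it is an
    involution there.  The S-symmetric elements are exactly the tau-symmetric
    elements of B ([symmetric_untwisted]): from tau (phi a) = a = tau a,
    commutation gives phi a = phi (tau a) = tau (phi a) = a.  If tau has order
    2 on B, the second theorem applies to (B, tau); if tau is the identity on
    B, then B consists of the S-symmetric elements and the first theorem
    applies again.

    The analytic content is that the fixed points are norm closed, i.e. that a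
    unital *-endomorphism phi does not increase the norm ([star_map_le]).  This
    can be seen without spectral theory.  For self-adjoint h with |h| < 1 there
    is a self-adjoint k commuting with h with h^2 + k^2 = 1; it is obtained by
    iterating a contraction ([sqrt_one_minus_sqr]).  Then phi h + i phi k is
    unitary, and phi h, its real part, has norm at most 1
    ([alg_norm_sqrD1]). *)

(** * Normed algebras through their real-valued norm *)

Section NormedAlgebraTheory.
Context {R : realType} {A : normedAlgType R}.
Implicit Types (a b : A) (e r : R).

Lemma normr_alg_norm a : `|a| = (alg_norm a)%:C.
Proof. by []. Qed.

Lemma alg_norm_ge0 a : 0 <= alg_norm a.
Proof. by rewrite -lecR -normr_alg_norm normr_ge0. Qed.

Lemma alg_norm0 : alg_norm (0 : A) = 0.
Proof. by apply: complexI; rewrite -normr_alg_norm normr0. Qed.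

Lemma alg_normZr r a : 0 <= r -> alg_norm (r%:C *: a) = r * alg_norm a.
Proof.
move=> r0; apply: complexI; rewrite alg_normZ rmorphM /=; congr (_ * _).
by rewrite ger0_norm// lecR.
Qed.

Lemma alg_normN a : alg_norm (- a) = alg_norm a.
Proof. by apply: complexI; rewrite -!normr_alg_norm normrN. Qed.

Lemma alg_normB a b : alg_norm (a - b) <= alg_norm a + alg_norm b.
Proof. by rewrite -(alg_normN b) alg_normD. Qed.

Lemma alg_distC a b : alg_norm (a - b) = alg_norm (b - a).
Proof. by rewrite -alg_normN opprB. Qed.

Lemma alg_distD b a c : alg_norm (a - c) <= alg_norm (a - b) + alg_norm (b - c).
Proof. by rewrite (le_trans _ (alg_normD _ _))// addrA subrK. Qed.

Lemma ball_alg_norm a b e : ball a e%:C b <-> alg_norm (a - b) < e.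
Proof. by rewrite -ball_normE /= normr_alg_norm ltcR. Qed.

Lemma pos_complex (c : R[i]) : 0 < c -> exists2 e, 0 < e & c = e%:C.
Proof.
by case: c => x y; rewrite ltcE /= => /andP[/eqP -> x0]; exists x.
Qed.

Lemma nbhs_alg_norm a (P : set A) :
  nbhs a P <-> exists2 e, 0 < e & forall b, alg_norm (a - b) < e -> P b.
Proof.
rewrite -nbhs_ballE; split => [[c /= /pos_complex[e e0 ->] aP]|[e e0 aP]].
  by exists e => // b /ball_alg_norm; exact: aP.
by exists e%:C => /= [|b /ball_alg_norm]; [rewrite ltcR|exact: aP].
Qed.

Lemma closure_alg_norm a (P : set A) :
  closure P a <-> forall e, 0 < e -> exists2 b, P b & alg_norm (a - b) < e.
Proof.
split=> [Pa e e0|Pa B /nbhs_alg_norm[e e0 aB]].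
  have /Pa[b [Pb ab]] : nbhs a [set b | alg_norm (a - b) < e].
    by apply/nbhs_alg_norm; exists e.
  by exists b.
by have [b Pb /aB Bb] := Pa _ e0; exists b.
Qed.

Lemma cauchy_alg_norm (F : set_system A) : ProperFilter F ->
  cauchy F <-> forall e, 0 < e -> exists a, F [set b | alg_norm (a - b) < e].
Proof.
move=> FF; split=> [/cauchyP Fc e e0|Fc];
  last apply/cauchyP => c /pos_complex[e e0 ->].
  have [|a Fa] := Fc e%:C; first by rewrite ltcR.
  by exists a; apply: filterS Fa => b /ball_alg_norm.
by have [a Fa] := Fc e e0; exists a; apply: filterS Fa => b /ball_alg_norm.
Qed.

Lemma dense_alg_norm (P : set A) :
  (forall a e, 0 < e -> exists2 b, P b & alg_norm (a - b) < e) -> dense P.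
Proof.
move=> PA O [a Oa] oO.
have /nbhs_alg_norm[e e0 aO] := open_nbhs_nbhs (conj oO Oa).
by have [b Pb /aO Ob] := PA a e e0; exists b.
Qed.

Lemma cvg_geometric0 (C : R) r : 0 <= r < 1 ->
  C * r ^+ n @[n --> \oo] --> (0 : R).
Proof.
move=> /andP[r0 r1]; rewrite -(mulr0 C); apply: cvgM; first exact: cvg_cst.
by apply: cvg_expr; rewrite ger0_norm.
Qed.

(** Equalities u = v satisfied by the limit of a geometrically convergent
    iteration are obtained with a := u - v, the bound being the convergence
    rate; this replaces continuity of the algebra operations. *)
Lemma alg_norm_geometric_eq0 a (C r : R) : 0 <= r < 1 ->
  (forall n, alg_norm a <= C * r ^+ n) -> a = 0.
Proof.
move=> r01 aC; apply: alg_norm0_eq0; apply/eqP.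
rewrite eq_le alg_norm_ge0 andbT.
have C0 := cvg_geometric0 C r01.
rewrite -(cvg_lim (@Rhausdorff R) C0); apply: limr_ge.
  by apply/cvg_ex; exists 0.
by near=> n; exact: aC.
Unshelve. all: by end_near. Qed.

Lemma cvg_geometric_iteration (z : nat -> A) r :
  norm_complete A -> 0 <= r < 1 ->
  (forall n, alg_norm (z n.+1 - z n) <= r ^+ n) ->
  exists l, forall n, alg_norm (l - z n) <= (1 - r)^-1 * r ^+ n.
Proof.
move=> cA r01 zr; have [r0 r1] := andP r01; set C := (1 - r)^-1.
have r1' : 1 - r != 0 by lra.
(* The increments from n to n + m form a geometric sum. *)
have zC n m : alg_norm (z (n + m)%N - z n) <= C * r ^+ n.
  have : alg_norm (z (n + m)%N - z n) <= C * (r ^+ n - r ^+ (n + m)).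
    elim: m => [|m IH]; first by rewrite addn0 !subrr alg_norm0 mulr0.
    have -> : C * (r ^+ n - r ^+ (n + m.+1))
        = r ^+ (n + m) + C * (r ^+ n - r ^+ (n + m)).
      by rewrite addnS exprS /C; field.
    by rewrite (le_trans (alg_distD (z (n + m)%N) _ _))// lerD// addnS.
  move=> /le_trans; apply; rewrite ler_wpM2l ?invr_ge0 ?subr_ge0 ?(ltW r1)//.
  by rewrite gerBl exprn_ge0.
have /cA /cvg_ex[l zl] : cauchy (z @ \oo).
  apply/cauchy_alg_norm => e e0.
  have C0 := cvg_geometric0 C r01.
  have [N _ /(_ N (leqnn _)) /= NC] := (cvgr_lt _ C0 _ e0).
  exists (z N); exists N => // n /= /subnKC <-.
  by rewrite alg_distC (le_lt_trans (zC _ _)).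
exists l => n; apply/ler_addgt0Pl => e e0.
have /zl [N _ Nl] : nbhs l [set b | alg_norm (l - b) < e].
  by apply/nbhs_alg_norm; exists e.
rewrite (le_trans (alg_distD (z (n + N)%N) _ _))// lerD// ltW//.
by apply: Nl => /=; rewrite leq_addl.
Qed.

End NormedAlgebraTheory.

(** * Square roots and unital star maps *)

Section CStarTheory.
Context {R : realType} {A : cstarAlgType R}.
Implicit Types (a b h x y : A) (c : R[i]) (r : R).

Lemma star0 : star (0 : A) = 0.
Proof. by apply: (@addrI _ (star 0)); rewrite -starD !addr0. Qed.

Lemma starN a : star (- a) = - star a.
Proof. by apply: (@addrI _ (star a)); rewrite -starD !subrr star0. Qed.

Lemma starB a b : star (a - b) = star a - star b.
Proof. by rewrite starD starN. Qed.

Lemma star1 : star (1 : A) = 1.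
Proof. by rewrite -[LHS]mulr1 -{2}[1](starK 1) -starM mulr1 starK. Qed.

Lemma starZr r a : star (r%:C *: a) = r%:C *: star a.
Proof. by rewrite starZ; congr (_ *: _); exact: conjc_real. Qed.

Lemma starZi a : star ('i%C *: a) = - ('i%C *: star a).
Proof.
rewrite starZ -scaleNr; congr (_ *: _); apply/eqP.
by rewrite eq_complex /= oppr0 !eqxx.
Qed.

Lemma alg_norm_star a : alg_norm (star a) = alg_norm a.
Proof.
suff le b : alg_norm b <= alg_norm (star b).
  by apply/eqP; rewrite eq_le le andbT -{2}(starK a).
have := alg_norm_ge0 b; rewrite le_eqVlt => /predU1P[<-|b0].
  exact: alg_norm_ge0.
by rewrite -(ler_pM2r b0) -expr2 -alg_norm_starM alg_normM.
Qed.

Lemma alg_norm1 : alg_norm (1 : A) = 1.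
Proof.
have n0 : alg_norm (1 : A) != 0.
  by apply/eqP => /alg_norm0_eq0/eqP; rewrite oner_eq0.
by apply: (mulfI n0); rewrite -expr2 -alg_norm_starM star1 !mulr1.
Qed.

(** The equation k^2 = 1 - c with c = h^2 becomes z = (c + z^2) / 2 for
    k = 1 - z.  On the ball of radius r = |c| < 1 the right-hand side is an
    r-contraction; the limit inherits self-adjointness and commutation with h
    from the iterates, which are polynomials in c. *)
Lemma sqrt_one_minus_sqr h : star h = h -> alg_norm h < 1 ->
  exists k, [/\ star k = k, h * k = k * h & k * k = 1 - h * h].
Proof.
move=> hh h1; pose c := h * h; pose r := alg_norm c.
have r01 : 0 <= r < 1.
  rewrite alg_norm_ge0 /= (le_lt_trans (alg_normM _ _))//.
  by rewrite mulr_ilt1 ?alg_norm_ge0.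
pose f (z : A) := (2^-1 : R)%:C *: (c + z * z).
have normZ x : alg_norm ((2^-1 : R)%:C *: x) = 2^-1 * alg_norm x.
  exact: alg_normZr.
pose z n := iter n f 0.
have zS n : z n.+1 = f (z n) by [].
have zr n : alg_norm (z n) <= r.
  elim: n => [|n IH]; first by rewrite alg_norm0; case/andP: r01.
  rewrite zS normZ; have := alg_normD c (z n * z n).
  have := alg_normM (z n) (z n); rewrite -/r.
  have := alg_norm_ge0 (z n); move: r01; nra.
have zz (M : R) x y : alg_norm x <= M -> alg_norm y <= M ->
    alg_norm (x * x - y * y) <= 2 * M * alg_norm (x - y).
  move=> xM yM.
  have -> : x * x - y * y = x * (x - y) + (x - y) * y.
    by rewrite mulrBr mulrBl addrA subrK.
  have := alg_normD (x * (x - y)) ((x - y) * y).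
  have := alg_normM x (x - y); have := alg_normM (x - y) y.
  have := alg_norm_ge0 (x - y); nra.
have zdist n : alg_norm (z n.+1 - z n) <= r ^+ n.
  elim: n => [|n IH].
    by rewrite subr0 (le_trans (zr 1%N))// ltW//; case/andP: r01.
  rewrite (zS n.+1) {2}(zS n) -scalerBr normZ opprD addrACA subrr add0r exprS.
  have := zz _ _ _ (zr n.+1) (zr n); move: r01 IH; nra.
have [l lz] := cvg_geometric_iteration (@cstar_complete R A) r01 zdist.
set C := (1 - r)^-1 in lz.
have zh n : z n * h = h * z n.
  elim: n => [|n IH]; first by rewrite mul0r mulr0.
  by rewrite zS -scalerAl -scalerAr /c mulrDl mulrDr -!mulrA IH !mulrA IH.
have zstar n : star (z n) = z n.
  elim: n => [|n IH]; first by rewrite star0.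
  by rewrite zS starZr starD /c !starM hh IH.
have lh : l * h - h * l = 0.
  apply: (alg_norm_geometric_eq0 (C := 2 * C * alg_norm h) r01) => n.
  have -> : l * h - h * l = (l - z n) * h - h * (l - z n).
    by rewrite mulrBl mulrBr zh opprB addrA subrK.
  have := alg_normB ((l - z n) * h) (h * (l - z n)).
  have := alg_normM (l - z n) h; have := alg_normM h (l - z n).
  have := lz n; have := alg_norm_ge0 h; nra.
have lstar : star l - l = 0.
  apply: (alg_norm_geometric_eq0 (C := 2 * C) r01) => n.
  have -> : star l - l = star (l - z n) - (l - z n).
    by rewrite starB zstar opprB addrA subrK.
  have := alg_normB (star (l - z n)) (l - z n).
  rewrite alg_norm_star; have := lz n; lra.
(* The iteration starts at 0, so C itself bounds the limit; C + r bounds the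
   limit and all iterates. *)
have lr : alg_norm l <= C + r.
  by have := lz 0%N; rewrite mulr1 subr0 => /le_trans; apply; move: r01; lra.
have C0 : 0 <= C by rewrite invr_ge0; move: r01; lra.
have fl : l - f l = 0.
  apply: (alg_norm_geometric_eq0 (C := C + (C + r) * C) r01) => n.
  (* |l - f l| <= |l - z (n+1)| + |f (z n) - f l|, since z (n+1) = f (z n). *)
  have znC : alg_norm (z n) <= C + r by have := zr n; lra.
  have := zz _ _ _ znC lr.
  have := alg_distD (z n.+1) l (f l).
  rewrite {2}zS -scalerBr normZ opprD addrACA subrr add0r.
  have lzS : alg_norm (l - z n.+1) <= C * r ^+ n.
    rewrite (le_trans (lz _))// ler_wpM2l// exprS.
    by rewrite ler_piMl ?exprn_ge0//; lra.
  have := ler_wpM2l (_ : 0 <= C + r) (lz n); rewrite (alg_distC l (z n)).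
  move=> /(_ ltac:(lra)). lra.
have {}fl : l = f l by exact: subr0_eq.
have l2 : l + l = c + l * l.
  rewrite {1 2}fl -scalerDl -rmorphD /=.
  by have -> : 2^-1 + 2^-1 = 1 :> R; [lra|rewrite scale1r].
exists (1 - l); split.
- by rewrite starB star1 (subr0_eq lstar).
- by rewrite mulrBl mulrBr mul1r mulr1 (subr0_eq lh).
- rewrite mulrBl mul1r mulrBr mulr1 -/c opprB addrACA -opprD l2.
  by rewrite (addrC c) addrKA.
Qed.

(** Commutation makes u = x + i y satisfy u* u = x^2 + y^2 = 1, so |u| = 1 by
    the C*-identity, and x is the mean of u and u*. *)
Lemma alg_norm_sqrD1 x y : star x = x -> star y = y -> x * y = y * x ->
  x * x + y * y = 1 -> alg_norm x <= 1.
Proof.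
move=> xs ys xy xy1; pose u := x + 'i%C *: y.
have us : star u = x - 'i%C *: y by rewrite starD starZi xs ys.
have i2 : 'i%C *: ('i%C *: (y * y)) = - (y * y).
  by rewrite scalerA -expr2 sqr_i scaleN1r.
have u1 : alg_norm u = 1.
  have : alg_norm u ^+ 2 = 1.
    rewrite -alg_norm_starM us -[RHS]alg_norm1; congr alg_norm.
    rewrite -xy1 mulrBl !mulrDr -!scalerAl -!scalerAr i2 xy.
    by rewrite opprD opprK addrA addrK.
  by move/eqP; rewrite sqrp_eq1 ?alg_norm_ge0// => /eqP.
have : alg_norm (x + x) <= 2.
  have -> : x + x = u + star u by rewrite us addrACA subrr addr0.
  by rewrite (le_trans (alg_normD _ _))// alg_norm_star u1.
have -> : alg_norm (x + x) = 2 * alg_norm x.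
  by rewrite -mulr2n -scaler_nat -(rmorph_nat (real_complex R)) alg_normZr.
by lra.
Qed.

(** Anti-multiplicative maps are included: every argument of this part tests
    phi only on squares, on commuting pairs and on the products a* a. *)
Record unital_star_map (p : product_kind) (phi : A -> A) : Prop :=
  UnitalStarMap {
  star_map_real_linear : real_linear phi ;
  star_map_scale : respects_scalars Linear phi ;
  star_map_product : respects_products p phi ;
  star_map_star : forall a, phi (star a) = star (phi a) ;
  star_map1 : phi 1 = 1 }.

Section StarMap.
Context (p : product_kind) (phi : A -> A) (phiP : unital_star_map p phi).

Lemma star_mapD a b : phi (a + b) = phi a + phi b.
Proof. by case: phiP => -[]. Qed.

Lemma star_mapZ c a : phi (c *: a) = c *: phi a.
Proof. by case: phiP. Qed.

Lemma star_mapB a b : phi (a - b) = phi a - phi b.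
Proof. by rewrite -scaleN1r star_mapD star_mapZ scaleN1r. Qed.

Lemma star_map_square a : phi (a * a) = phi a * phi a.
Proof. by have := star_map_product phiP; case: p => ->. Qed.

Lemma star_map_comm a b : a * b = b * a -> phi a * phi b = phi b * phi a.
Proof.
move=> /(congr1 phi); have := star_map_product phiP.
by case: p => /= pM; rewrite !pM.
Qed.

(** Rescaling reduces to norm below 1, where h is completed to a pair with
    h^2 + k^2 = 1; phi preserves this relation. *)
Lemma star_map_sa_le h : star h = h -> alg_norm (phi h) <= alg_norm h.
Proof.
move=> hs; apply/ler_addgt0Pr => e e0; pose t := alg_norm h + e.
have t0 : 0 < t by rewrite ltr_wpDl ?alg_norm_ge0.
have normZ x : alg_norm (t^-1%:C *: x) = t^-1 * alg_norm x.
  by rewrite alg_normZr// invr_ge0 ltW.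
rewrite -/t -[leRHS]mulr1 -ler_pdivrMl// -normZ -star_mapZ.
set g := _ *: h; have gs : star g = g by rewrite starZr hs.
have g1 : alg_norm g < 1 by rewrite normZ ltr_pdivrMl// mulr1 ltrDl.
have [k [ks gk kk]] := sqrt_one_minus_sqr gs g1.
apply: (@alg_norm_sqrD1 _ (phi k)).
- by rewrite -(star_map_star phiP) gs.
- by rewrite -(star_map_star phiP) ks.
- exact: star_map_comm.
- by rewrite -!star_map_square -star_mapD kk addrC subrK (star_map1 phiP).
Qed.

(** The C*-identity reduces to the self-adjoint elements a* a and a a*, the
    latter for anti-multiplicative phi. *)
Lemma star_map_le a : alg_norm (phi a) <= alg_norm a.
Proof.
rewrite -(@ler_pXn2r _ 2)// ?nnegrE ?alg_norm_ge0//.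
have := star_map_product phiP; case: p => /= pM.
  rewrite -!alg_norm_starM -(star_map_star phiP) -pM star_map_sa_le//.
  by rewrite starM starK.
rewrite -alg_norm_starM -(star_map_star phiP) -pM.
rewrite -(alg_norm_star a) -alg_norm_starM starK star_map_sa_le//.
by rewrite starM starK.
Qed.

End StarMap.

End CStarTheory.

(** * The C*-algebra of common fixed points *)

Section FixedAlgebra.
Context {R : realType} {A : cstarAlgType R}.

(** The closure properties of the fixed points are bundled with the family, so
    that the algebra structures below can be inferred from the family. *)
Record star_endos := StarEndos {
  endos :> set (A -> A) ;
  endosP : forall phi, endos phi -> unital_star_map Defs.Multiplicative phi }.

Variable T : star_endos.

Definition fixed_pred : {pred A} := fun a => `[< symmetric_elements T a >].

Lemma fixed_predP a : reflect (symmetric_elements T a) (a \in fixed_pred).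
Proof. exact: asboolP. Qed.

Lemma fixed_subalg_closed : GRing.subalg_closed fixed_pred.
Proof.
split=> [|c a b|a b].
- by apply/fixed_predP => phi /endosP /star_map1.
- move=> /fixed_predP Ta /fixed_predP Tb; apply/fixed_predP => phi Tphi.
  by rewrite (star_mapD (endosP Tphi)) (star_mapZ (endosP Tphi)) Ta// Tb.
- move=> /fixed_predP Ta /fixed_predP Tb; apply/fixed_predP => phi Tphi.
  by rewrite (star_map_product (endosP Tphi)) Ta// Tb.
Qed.

Lemma fixed_star_closed a : a \in fixed_pred -> star a \in fixed_pred.
Proof.
move=> /fixed_predP Ta; apply/fixed_predP => phi Tphi.
by rewrite (star_map_star (endosP Tphi)) Ta.
Qed.

HB.instance Definition _ := GRing.isSubalgClosed.Build R[i] A fixed_pred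
  fixed_subalg_closed.

Record fixed_alg := FixedAlg { fixed_val :> A ; _ : fixed_val \in fixed_pred }.

HB.instance Definition _ := [isSub for fixed_val].
HB.instance Definition _ := [Choice of fixed_alg by <:].
HB.instance Definition _ := [SubChoice_isSubAlgebra of fixed_alg by <:].

Definition fixed_norm (u : fixed_alg) : R := alg_norm (val u).

Lemma fixed_normD u v : fixed_norm (u + v) <= fixed_norm u + fixed_norm v.
Proof. exact: alg_normD. Qed.

Lemma fixed_normZ (c : R[i]) u :
  (fixed_norm (c *: u))%:C = `|c| * (fixed_norm u)%:C.
Proof. exact: alg_normZ. Qed.

Lemma fixed_norm_eq0 u : fixed_norm u = 0 -> u = 0.
Proof. by move=> /alg_norm0_eq0 u0; exact: val_inj. Qed.

Lemma fixed_normM u v : fixed_norm (u * v) <= fixed_norm u * fixed_norm v.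
Proof. exact: alg_normM. Qed.

HB.instance Definition _ := isNormedAlgebra.Build R fixed_alg
  fixed_normD fixed_normZ fixed_norm_eq0 fixed_normM.

(** Closedness holds because unital star maps do not increase the norm. *)
Lemma fixed_closed (a : A) :
  (forall e : R, 0 < e -> exists u : fixed_alg, alg_norm (a - val u) < e) ->
  a \in fixed_pred.
Proof.
move=> au; apply/fixed_predP => phi Tphi; apply: subr0_eq.
apply: alg_norm0_eq0; apply/eqP; rewrite eq_le alg_norm_ge0 andbT.
apply/ler_addgt0Pr => e e0; rewrite add0r.
have e2 : 0 < e / 2 by rewrite divr_gt0.
have [u ue] := au _ e2.
rewrite (le_trans (alg_distD (val u) _ _))// (alg_distC _ a).
have uT : phi (val u) = val u by case: u {ue} => u /= /fixed_predP; exact.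
rewrite -{1}uT -(star_mapB (endosP Tphi)).
have := star_map_le (endosP Tphi) (a - val u) => phiau.
by rewrite ltW// (splitr e) ltrD// (le_lt_trans phiau).
Qed.

Lemma fixed_complete : norm_complete fixed_alg.
Proof.
move=> F FF /cauchy_alg_norm Fc; apply/cvg_ex.
have /cstar_complete /cvg_ex [/= l Fl] : cauchy (val @ F : set_system A).
  by apply/cauchy_alg_norm => e /Fc [u Fu]; exists (val u).
have near_l e : 0 < e -> F [set u | alg_norm (l - val u) < e].
  by move=> e0; have /Fl : nbhs l [set b | alg_norm (l - b) < e]
    by apply/nbhs_alg_norm; exists e.
have lT : l \in fixed_pred.
  by apply: fixed_closed => e /near_l /filter_ex.
exists (FixedAlg lT) => B /nbhs_alg_norm [e /near_l le lB].
by apply: filterS le => u ?; exact: lB.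
Qed.

Definition fixed_star (u : fixed_alg) : fixed_alg :=
  FixedAlg (fixed_star_closed (valP u)).

Lemma fixed_starK : involutive fixed_star.
Proof. by move=> u; apply: val_inj; exact: starK. Qed.

Lemma fixed_starD u v : fixed_star (u + v) = fixed_star u + fixed_star v.
Proof. by apply: val_inj; exact: starD. Qed.

Lemma fixed_starZ (c : R[i]) u : fixed_star (c *: u) = c^* *: fixed_star u.
Proof. by apply: val_inj; exact: starZ. Qed.

Lemma fixed_starM u v : fixed_star (u * v) = fixed_star v * fixed_star u.
Proof. by apply: val_inj; exact: starM. Qed.

Lemma fixed_norm_starM u : alg_norm (fixed_star u * u) = alg_norm u ^+ 2.
Proof. exact: alg_norm_starM. Qed.

HB.instance Definition _ := isCStarAlgebra.Build R fixed_alg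
  fixed_complete fixed_starK fixed_starD fixed_starZ fixed_starM
  fixed_norm_starM.

(** An inverse b in the big algebra is fixed as well, by uniqueness of
    inverses, so invertibility in both algebras is the same. *)
Lemma fixed_invertible (u : fixed_alg) :
  invertible_elt (val u) -> invertible_elt u.
Proof.
move=> [b [ub bu]]; have bT : b \in fixed_pred.
  apply/fixed_predP => phi Tphi.
  rewrite -[LHS]mulr1 -ub mulrA -(fixed_predP _ (valP u) _ Tphi).
  rewrite -(star_map_product (endosP Tphi)) bu.
  by rewrite (star_map1 (endosP Tphi)) mul1r.
by exists (FixedAlg bT); split; apply: val_inj.
Qed.

End FixedAlgebra.

(** * Reduction to a single involution *)

Section SymmetryMaps.
Context {R : realType} {A : cstarAlgType R}.
Implicit Types (phi tau : A -> A) (S : set (A -> A)).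

Lemma symmetry_star_map phi : symmetry_map phi -> respects_scalars Linear phi ->
  unital_star_map Defs.Multiplicative phi \/
  unital_star_map AntiMultiplicative phi.
Proof.
by case=> rl st _ p1 [s [[] [_ pM]]] lin; [left|right]; split.
Qed.

Lemma TR_rank1_alg_norm S a (e : R) :
  TR_rank1 S -> symmetric_elements S a -> 0 < e ->
  exists b, [/\ symmetric_elements S b, invertible_elt b &
    alg_norm (a - b) < e].
Proof.
by move=> trS /trS /closure_alg_norm/(_ e) Sa /Sa [b [Sb bi] ab]; exists b.
Qed.

Lemma fixed_stable_rank1 (T : @star_endos R A) :
  TR_rank1 T -> stable_rank1 (fixed_alg T).
Proof.
move=> trT; apply: dense_alg_norm => u e e0.
have [b [Tb bi ub]] := TR_rank1_alg_norm trT (fixed_predP _ _ (valP u)) e0.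
have bT : b \in fixed_pred T by exact/fixed_predP.
by exists (FixedAlg bT) => //; exact: fixed_invertible.
Qed.

(** With tau anti-multiplicative in S, this consists of multiplicative maps
    that fix every S-symmetric element; it contains tau^2. *)
Definition untwist tau S : set (A -> A) :=
  [set phi | S phi /\ unital_star_map Defs.Multiplicative phi] `|`
  [set tau \o phi | phi in
    [set phi | S phi /\ unital_star_map AntiMultiplicative phi]].

Lemma comp_anti_star_map phi psi : unital_star_map AntiMultiplicative phi ->
  unital_star_map AntiMultiplicative psi ->
  unital_star_map Defs.Multiplicative (phi \o psi).
Proof.
move=> [[pD pr] pZ pM pS p1] [[qD qr] qZ qM qS q1]; split=> /=.
- by split=> * /=; [rewrite qD pD|rewrite qr pr].
- by move=> *; rewrite /= qZ pZ.
- by move=> *; rewrite /= qM pM.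
- by move=> *; rewrite /= qS pS.
- by rewrite q1 p1.
Qed.

Lemma untwistP tau S : unital_star_map AntiMultiplicative tau ->
  forall phi, untwist tau S phi -> unital_star_map Defs.Multiplicative phi.
Proof.
by move=> ta phi [[]//|[psi [_ ps] <-]]; exact: comp_anti_star_map.
Qed.

Section Twist.
Context (S : set (A -> A)) (tau : A -> A).
Hypotheses (Slin : linear_symmetries S) (Stau : S tau)
  (ta : unital_star_map AntiMultiplicative tau)
  (tauC : forall phi, S phi -> tau \o phi =1 phi \o tau).

Definition untwisted := StarEndos (untwistP (S := S) ta).

Lemma tau_untwisted a :
  a \in fixed_pred untwisted -> tau a \in fixed_pred untwisted.
Proof.
move=> /fixed_predP Ta; apply/fixed_predP => phi.
case=> [[Sphi pm]|[psi [Spsi pa] <-]] /=.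
  by rewrite -[LHS](tauC Sphi) /= Ta//; left.
rewrite -[X in tau X](tauC Spsi) /=; congr tau.
by apply: (Ta (tau \o psi)); right; exists psi.
Qed.

Definition untwisted_tau (u : fixed_alg untwisted) : fixed_alg untwisted :=
  FixedAlg (tau_untwisted (valP u)).

Lemma untwisted_tauK : involutive untwisted_tau.
Proof.
move=> u; apply: val_inj => /=; apply: (fixed_predP _ _ (valP u) (tau \o tau)).
by right; exists tau.
Qed.

(** The direction from right to left needs tau to commute with S: for
    anti-multiplicative phi in S, phi a = phi (tau a) = tau (phi a) = a. *)
Lemma symmetric_untwisted a : symmetric_elements S a <->
  symmetric_elements untwisted a /\ tau a = a.
Proof.
split=> [Sa|[Ta taua] phi Sphi].
  split; last exact: Sa.
  by move=> phi [[/Sa//]|[psi [/Sa pa _] <-]]; rewrite /= pa Sa.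
have [sphi lphi] := Slin Sphi.
case: (symmetry_star_map sphi lphi) => [pm|pa]; first by apply: Ta; left.
have tpa : tau (phi a) = a by apply: (Ta (tau \o phi)); right; exists phi.
by rewrite -[RHS]tpa -[LHS](congr1 phi taua) -[LHS](tauC Sphi).
Qed.

Lemma symmetric_untwisted_tau (u : fixed_alg untwisted) :
  symmetric_elements [set untwisted_tau] u <-> symmetric_elements S (val u).
Proof.
have uT := fixed_predP _ _ (valP u).
split=> [/(_ _ erefl) /(congr1 val) tu|/symmetric_untwisted [_ tu] _ ->].
  exact/symmetric_untwisted.
exact: val_inj.
Qed.

Lemma untwisted_tau_type : has_type Linear AntiMultiplicative untwisted_tau.
Proof.
split=> [c u|u v]; apply: val_inj; first exact: (star_map_scale ta).
exact: (star_map_product ta).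
Qed.

(** Non-invertible elements stay so: the image of an inverse of tau u under
    the involution is an inverse of u. *)
Lemma untwisted_tau_symmetry : symmetry_map untwisted_tau.
Proof.
split.
- split=> [u v|r u]; apply: val_inj; first exact: (star_mapD ta).
  exact: (star_mapZ ta).
- by move=> u; apply: val_inj; exact: (star_map_star ta).
- move=> u nu; apply: contra_not nu => -[v [uv vu]].
  exists (untwisted_tau v); have [_ tM] := untwisted_tau_type.
  have t1 : untwisted_tau 1 = 1 by apply: val_inj; exact: star_map1 ta.
  by rewrite -{1 2}[u]untwisted_tauK -!tM uv vu.
- by apply: val_inj; exact: star_map1 ta.
- by exists Linear, AntiMultiplicative; exact: untwisted_tau_type.
Qed.

Lemma untwisted_tau_TR_rank1 : TR_rank1 S -> TR_rank1 [set untwisted_tau].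
Proof.
move=> trS u /symmetric_untwisted_tau Su; apply/closure_alg_norm => e e0.
have [b [Sb bi ub]] := TR_rank1_alg_norm trS Su e0.
have bT : b \in fixed_pred untwisted.
  by apply/fixed_predP; have [] := (symmetric_untwisted b).1 Sb.
exists (FixedAlg bT) => //; split; first exact/symmetric_untwisted_tau.
exact: fixed_invertible.
Qed.

Lemma untwisted_tau_order :
  ~ (untwisted_tau =1 id) -> has_order untwisted_tau 2.
Proof.
move=> tn1; split=> // [u|[|[|j]]]//; exact: untwisted_tauK.
Qed.
End Twist.

End SymmetryMaps.

Theorem theorem4p5 (R : realType) (eps1 eps2 : R -> R)
  (eps1_gauge : monotone_gauge eps1) (eps2_gauge : monotone_gauge eps2)
  (eps1P : forall B : cstarAlgType R, stable_rank1 B ->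
    forall a : B, cstar_contraction a ->
    exists a' : B, cstar_normal a' /\
      alg_norm (a' - a) <= eps1 (alg_norm (cstar_commutator (star a) a)))
  (eps2P : forall (B : cstarAlgType R) (tau : B -> B),
    symmetry_map tau -> has_type Linear AntiMultiplicative tau ->
    has_order tau 2 -> TR_rank1 [set tau] ->
    forall a : B, symmetric_elements [set tau] a -> cstar_contraction a ->
    exists a' : B, [/\ cstar_normal a', symmetric_elements [set tau] a' &
      alg_norm (a' - a) <= eps2 (alg_norm (cstar_commutator (star a) a))])
  (A : cstarAlgType R) (S : set (A -> A)) :
  linear_symmetries S -> admissible S -> TR_rank1 S ->
  forall a : A, symmetric_elements S a -> cstar_contraction a ->
  exists a' : A, [/\ cstar_normal a', symmetric_elements S a' &
    alg_norm (a' - a) <= Num.max (eps1 (alg_norm (cstar_commutator (star a) a)))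
                              (eps2 (alg_norm (cstar_commutator (star a) a)))].
Proof.
move=> Slin Sadm trS a Sa a1.
set d := alg_norm _; rewrite -/d.
(* Both cases in which the symmetric elements form an algebra end here. *)
have via_eps1 (T : @star_endos R A) :
    (forall b, symmetric_elements T b <-> symmetric_elements S b) ->
    exists a' : A, [/\ cstar_normal a', symmetric_elements S a' &
      alg_norm (a' - a) <= eps1 d].
  move=> TS; have trT : TR_rank1 T.
    have -> // : TR_rank1 T = TR_rank1 S.
    by rewrite /TR_rank1; have -> : symmetric_elements T = symmetric_elements S
      by apply/seteqP; split=> b /TS.
  have aT : a \in fixed_pred T by apply/fixed_predP/TS.
  have [u [un ua]] := eps1P _ (fixed_stable_rank1 trT) (FixedAlg aT) a1.
  exists (val u); split=> //; first exact: (congr1 val un).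
  by apply/TS/fixed_predP/valP.
have le1 : eps1 d <= Num.max (eps1 d) (eps2 d) by rewrite le_max lexx.
have [anti|noanti] := pselect (exists2 psi, S psi &
    has_type Linear AntiMultiplicative psi); last first.
  have Sm phi : S phi -> unital_star_map Defs.Multiplicative phi.
    move=> Sphi; have [sphi lphi] := Slin _ Sphi.
    have [//|[_ lin pa _ _]] := symmetry_star_map sphi lphi.
    by case: noanti; exists phi.
  have [b|a' [an aS ad]] := via_eps1 (StarEndos Sm); first by split.
  by exists a'; split=> //; exact: le_trans le1.
have [//|tau [Stau [_ taua] tauC]] := Sadm Linear AntiMultiplicative _ anti.
have [[rl st _ t1 _] lin] := Slin _ Stau.
have ta : unital_star_map AntiMultiplicative tau by split.
pose T := untwisted S ta.
pose tauT : fixed_alg T -> fixed_alg T := untwisted_tau tauC.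
have SE := symmetric_untwisted Slin Stau ta tauC.
have [tauT1|tauTn1] := pselect (tauT =1 id).
  have [b|a' [an aS ad]] := via_eps1 T; last first.
    by exists a'; split=> //; exact: le_trans le1.
  (* Here every element of the algebra is tau-symmetric. *)
  split=> [Tb|/SE []//]; apply/SE; split=> //.
  have bT : b \in fixed_pred T by exact/fixed_predP.
  exact: (congr1 val (tauT1 (FixedAlg bT))).
have aT : a \in fixed_pred T by apply/fixed_predP; have /SE[] := Sa.
have tauTE := symmetric_untwisted_tau Slin Stau (ta := ta) tauC.
have [u [un /tauTE uS ua]] := eps2P _ tauT
  (untwisted_tau_symmetry Stau ta tauC) (untwisted_tau_type ta tauC)
  (untwisted_tau_order Stau tauTn1) (untwisted_tau_TR_rank1 Slin Stau trS)
  (FixedAlg aT) ((tauTE (FixedAlg aT)).2 Sa) a1.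
exists (val u); split=> //; first exact: (congr1 val un).
by rewrite le_max orbC (le_trans ua).
Qed.
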